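(* For every integer $n \geq 3$: \begin{align*} f_{(n,3,3),2} &= q^9 \begin{bmatrix} n-1 \\ 2 \end{bmatrix}_q, \\ f_{(n,3,3),3} &= q^{11} \begin{bmatrix} n-1 \\ 2 \end{bmatrix}_q \begin{bmatrix} n+3 \\ 1 \end{bmatrix}_q + q^{12} \begin{bmatrix} n \\ 3 \end{bmatrix}_q \begin{bmatrix} 4 \\ 1 \end{bmatrix}_q, \\ f_{(n,3,3),4} &= q^{15} \begin{bmatrix} n-1 \\ 2 \end{bmatrix}_q \begin{bmatrix} n+2 \\ 2 \end{bmatrix}_q + q^{15} \begin{bmatrix} n+1 \\ 4 \end{bmatrix}_q \begin{bmatrix} 5 \\ 2 \end{bmatrix}_q, \\ f_{(n,3,3),5} &= q^{21} \begin{bmatrix} n-1 \\ 2 \end{bmatrix}_q \begin{bmatrix} n+1 \\ 3 \end{bmatrix}_q + q^{20} \begin{bmatrix} n+1 \\ 4 \end{bmatrix}_q \begin{bmatrix} n+3 \\ 1 \end{bmatrix}_q, \\ f_{(n,3,3),6} &= q^{27} \frac{(1-q^{n-2})(1-q^{n-1})^2 (1-q^n)^2(1-q^{n+1})}{(1-q)(1-q^2)^2(1-q^3)^2 (1-q^4)} = q^{27} \begin{bmatrix} n \\ 3 \end{bmatrix}_q^2 - q^{28} \begin{bmatrix} n \\ 4 \end{bmatrix}_q \begin{bmatrix} n \\ 2 \end{bmatrix}_q. \end{align*}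
   Context: For a partition $\lambda\vdash N$, a standard Young tableau of shape $\lambda$ is a filling of the Ferrers diagram with $1,\dots,N$, increasing along rows and down columns; it has a descent at $m$ if $m+1$ lies in a strictly lower row than $m$; $\mathrm{des}$ is the number of descents and $\mathrm{maj}$ their sum. $f_{\lambda,i}(q)=\sum q^{\mathrm{maj}(\tau)}$ over standard Young tableaux of shape $\lambda$ with $\mathrm{des}(\tau)=i$. The $q$-binomial coefficient is $\frac{(q)_M}{(q)_N(q)_{M-N}}$, $(q)_m=(1-q)\cdots(1-q^m)$, for integers $0\le N\le M$, and $0$ otherwise. *)

(* Defs.v *)
From HB Require Import structures.
From mathcomp Require Import all_boot all_order all_algebra fraction.
Set Implicit Arguments. Unset Strict Implicit. Unset Printing Implicit Defensive.
Import Order.TTheory GRing.Theory Num.Theory.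

(* A partition is a seq nat (weakly decreasing, positive parts); N = sumn la.
   A filling of shape la is encoded as a finite function from the index box
   'I_(size la) * 'I_N (row i, column j, 0-based, English convention: row
   index grows downwards) to 'I_N.+1.  Cells (i,j) with j < la_i are the cells
   of the Ferrers diagram; outside cells are forced to carry the dummy value 0
   so that each tableau has exactly one encoding. *)

Definition tabl (la : seq nat) := {ffun 'I_(size la) * 'I_(sumn la) -> 'I_(sumn la).+1}.

Definition in_shape (la : seq nat) (c : 'I_(size la) * 'I_(sumn la)) : bool :=
  c.2 < nth 0 la c.1.

Definition is_syt (la : seq nat) (T : tabl la) : bool :=
  [&& [forall c, ~~ in_shape c ==> (T c == ord0)],
      [forall c, in_shape c ==> (0 < T c)],
      [forall m : 'I_(sumn la).+1, (0 < m) ==> [exists c, in_shape c && (T c == m)]],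
      [forall c, forall d, [&& in_shape c, in_shape d & T c == T d] ==> (c == d)],
      [forall c, forall d, [&& in_shape c, in_shape d, c.1 == d.1 :> nat & c.2 < d.2]
                             ==> (T c < T d)] &
      [forall c, forall d, [&& in_shape c, in_shape d, c.2 == d.2 :> nat & c.1 < d.1]
                             ==> (T c < T d)]].

Definition row_of (la : seq nat) (T : tabl la) (m : nat) : nat :=
  if [pick c | in_shape c && (val (T c) == m)] is Some c then val c.1 else 0.

Definition descent (la : seq nat) (T : tabl la) (m : nat) : bool :=
  row_of T m < row_of T m.+1.

Definition descents (la : seq nat) (T : tabl la) : seq nat :=
  [seq m <- iota 1 (sumn la).-1 | descent T m].

Definition des (la : seq nat) (T : tabl la) : nat := size (descents T).
Definition maj (la : seq nat) (T : tabl la) : nat := sumn (descents T).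

Local Open Scope ring_scope.

Definition fpoly (la : seq nat) (i : nat) : {poly int} :=
  \sum_(T : tabl la | is_syt T && (des T == i)) 'X^(maj T).

Notation qfrac := {fraction {poly int}}.
Definition tofracq (p : {poly int}) : qfrac := @FracField.tofrac _ p.
Notation "x %:F" := (tofracq x) : ring_scope.

Definition qpoch (m : nat) : {poly int} := \prod_(1 <= k < m.+1) (1 - 'X^k).

Definition qbinom (M N : nat) : qfrac :=
  if (N <= M)%N then
    (qpoch M)%:F / ((qpoch N)%:F * (qpoch (M - N))%:F)
  else 0.

Definition fq (la : seq nat) (i : nat) : qfrac := (fpoly la i)%:F.
Definition qX (k : nat) : qfrac := ('X^k : {poly int})%:F.
Definition omq (k : nat) : qfrac := (1 - 'X^k : {poly int})%:F.

(* Main.v *)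
Require Import Defs.
From HB Require Import structures.
From mathcomp Require Import all_boot all_order all_algebra fraction.
From mathcomp Require Import zify ring.
Set Implicit Arguments. Unset Strict Implicit. Unset Printing Implicit Defensive.
Import GRing.Theory.

(* A standard tableau is encoded by the lattice word of the rows of its entries,
   read from the largest entry down to 1; descents and major index depend on
   this word only.  Removing the largest entry gives a recursion for the sums of
   q^maj refined by the number of descents and by the row of the largest entry.
   For shapes (a, b, c) with c <= b <= 3 the sums are rational functions of q
   and x = q^a that vanish at a = b - 1, so the recursion in a, checked as a
   rational identity in q and x, determines them. *)

(** * Words, their statistics and the lattice condition *)

(* Words are read backwards: the head of a word of length [N] is the row of the
   entry [N].  Positions are counted from 1, starting at the end of the word. *)
Fixpoint word_des (u : seq nat) : nat :=
  if u is x :: v then (head x v < x) + word_des v else 0.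

Fixpoint word_maj (u : seq nat) : nat :=
  if u is x :: v then (head x v < x) * size v + word_maj v else 0.

Definition content (k : nat) (u : seq nat) : seq nat :=
  [seq count_mem r u | r <- iota 0 k].

(** Yamanouchi condition: every nonempty suffix has a partition as content. The suffix of length [m]
    corresponds to the subtableau of the entries at most [m]. *)
Fixpoint lattice (k : nat) (u : seq nat) : bool :=
  if u is _ :: v then sorted geq (content k u) && lattice k v else true.

(** For the word of a tableau this is row [r] read from left to right: the head letter of [u]
    belongs to the entry [size u], hence the [rcons]. *)
Fixpoint positions (r : nat) (u : seq nat) : seq nat :=
  if u is x :: v then
    if x == r then rcons (positions r v) (size u) else positions r v
  else [::].

Fixpoint word_of (f : nat -> nat) (N : nat) : seq nat :=
  if N is M.+1 then f N :: word_of f M else [::].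

Fixpoint words (k N : nat) : seq (seq nat) :=
  if N is M.+1 then [seq x :: u | x <- iota 0 k, u <- words k M] else [:: [::]].

Lemma size_word_of f N : size (word_of f N) = N.
Proof. by elim: N => //= N ->. Qed.

Lemma iotaSr m n : iota m n.+1 = rcons (iota m n) (m + n).
Proof. by rewrite -addn1 iotaD cats1. Qed.

Lemma word_des_word_of f N :
  word_des (word_of f N) = size [seq m <- iota 1 N.-1 | f m < f m.+1].
Proof.
(* On a one-letter word [head] falls back on that same letter, so no descent is counted at the end
   of the word. *)
elim: N => // -[|N] IH; first by rewrite /= ltnn.
have -> : word_des (word_of f N.+2)
          = (f N.+1 < f N.+2) + word_des (word_of f N.+1) by [].
rewrite {}IH [N.+2.-1]/= iotaSr filter_rcons add1n.
by case: ltnP => _; rewrite ?size_rcons.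
Qed.

Lemma word_maj_word_of f N :
  word_maj (word_of f N) = sumn [seq m <- iota 1 N.-1 | f m < f m.+1].
Proof.
elim: N => // -[|N] IH; first by rewrite /= ltnn.
have -> : word_maj (word_of f N.+2)
          = (f N.+1 < f N.+2) * size (word_of f N.+1)
            + word_maj (word_of f N.+1) by [].
rewrite {}IH size_word_of [N.+2.-1]/= iotaSr.
rewrite filter_rcons add1n; case: ltnP => _ //.
by rewrite sumn_rcons mul1n addnC.
Qed.

Lemma mem_words k N u : (u \in words k N) = (size u == N) && all (gtn k) u.
Proof.
elim: N u => [|N IH] [|x u] //=.
  by apply/negbTE/negP => /allpairsP[[y v] []].
rewrite eqSS; apply/allpairsP/idP => [[[y v] /= [hy hv [-> ->]]]|].
  by move: hy hv; rewrite mem_iota IH add0n => /= -> /andP[-> ->].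
move=> /and3P[hs hx ha]; exists (x, u); split=> //=.
  by rewrite mem_iota add0n.
by rewrite IH hs.
Qed.

Lemma words_uniq k N : uniq (words k N).
Proof.
elim: N => //= N IH; apply: allpairs_uniq => //; first exact: iota_uniq.
by move=> [x u] [y v] _ _ /= [-> ->].
Qed.

Lemma size_positions r u : size (positions r u) = count_mem r u.
Proof. by elim: u => //= x u IH; case: eqP => _; rewrite ?size_rcons IH. Qed.

Lemma mem_positions r u m :
  (m \in positions r u) = (0 < m <= size u) && (nth 0 u (size u - m) == r).
Proof.
elim: u m => [|x u IH] m /=; first by rewrite leqn0; case: m.
have [->|ne] := eqVneq m (size u).+1.
  rewrite ltnSn subnn /=; case: eqP => _; first by rewrite mem_rcons inE eqxx.
  by rewrite IH ltnn andbF.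
have -> : m <= (size u).+1 = (m <= size u) by rewrite leq_eqVlt (negbTE ne).
rewrite (fun_if (fun s => m \in s)) mem_rcons inE (negbTE ne) /= if_same IH.
by case: (leqP m (size u)) => [h|_]; rewrite ?andbF // subSn.
Qed.

Lemma positions_le r u m : m \in positions r u -> 0 < m <= size u.
Proof. by rewrite mem_positions => /andP[]. Qed.

Lemma nth_positions_le r u j :
  j < count_mem r u -> 0 < nth 0 (positions r u) j <= size u.
Proof. by rewrite -size_positions => /(mem_nth 0)/positions_le. Qed.

Lemma positions_sorted r u : sorted ltn (positions r u).
Proof.
rewrite (sorted_pairwise ltn_trans).
elim: u => //= x u IH; case: eqP => _ //; rewrite pairwise_rcons IH andbT.
by apply/allP => m /positions_le /andP[_]; rewrite /= ltnS.
Qed.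

Lemma nth_word_of f N m :
  0 < m <= N -> nth 0 (word_of f N) (N - m) = f m.
Proof.
elim: N => [|N IH]; first by case: m.
case/andP=> m0; rewrite leq_eqVlt => /predU1P[->|hm]; first by rewrite subnn.
by rewrite subSn //= IH // m0.
Qed.

Lemma nth_rcons_lt (s : seq nat) x j : j < size s -> nth 0 (rcons s x) j = nth 0 s j.
Proof. by rewrite nth_rcons => ->. Qed.

Lemma content_sortedP k u :
  reflect (forall r s, r < s < k -> count_mem s u <= count_mem r u)
          (sorted geq (content k u)).
Proof.
rewrite /content; apply: (iffP idP) => [so r s /andP[rs sk]|H].
  have tr : transitive geq.
    by move=> a b c; rewrite /= => h1 h2; apply: leq_trans h2 h1.
  have /(sorted_ltn_nth tr 0) := so.
  move=> /(_ r s); rewrite !inE size_map size_iota.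
  move=> /(_ (ltn_trans rs sk) sk rs).
  by rewrite !(nth_map 0) ?size_iota ?nth_iota //; apply: ltn_trans sk.
apply: (path_sorted (x := count_mem 0 u)).
apply/(pathP 0) => i; rewrite size_map size_iota => ik.
case: i ik => [|i] ik /=.
  by rewrite (nth_map 0) ?size_iota // nth_iota.
rewrite !(nth_map 0) ?size_iota ?nth_iota //; try exact: ltnW.
by apply: H; rewrite !add0n ltnSn.
Qed.

(** Column-strictness in terms of words: no suffix contains more [s] than [r] exactly when the j-th
    [s] is always preceded, in increasing position, by the j-th [r]. *)
Lemma latticeP k u :
  lattice k u <-> forall r s, r < s < k -> count_mem s u <= count_mem r u /\
    forall j, j < count_mem s u ->
      nth 0 (positions r u) j < nth 0 (positions s u) j.
Proof.
elim: u => [|x u IH]; first by split.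
split=> [/andP[/content_sortedP so /IH{}IH] r s rsk|H].
  split=> [|j]; first exact: so.
  have [le_sr lt_sr] := IH _ _ rsk.
  have /= := so _ _ rsk; have rs : r < s by case/andP: rsk.
  (* If the new letter is [s], its partner [r] already occurs in [u], hence at a position at most
     [size u]. *)
  case: (eqVneq x s) => [->|xs] /=.
    rewrite -[s == r]negbK neq_ltn rs orbT /= add0n add1n => hs hj.
    rewrite (nth_rcons _ (positions s u)) size_positions.
    move: hj; rewrite ltnS leq_eqVlt => /predU1P[->|hj]; last by rewrite hj lt_sr.
    by rewrite ltnn eqxx ltnS; case/andP: (nth_positions_le hs).
  rewrite add0n => hs hj; have hr := leq_trans hj le_sr.
  case: eqP => _; last exact: lt_sr.
  by rewrite nth_rcons_lt ?size_positions // lt_sr.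
apply/andP; split; first by apply/content_sortedP => r s /H[].
apply/IH => r s rsk.
have [hc hn] := H _ _ rsk.
have rs : r < s by case/andP: rsk.
(* If [u] had more [s] than [r], the new letter would have to be an [r], at position [size u + 1];
   it would be paired with an [s] of [u], whose position is smaller. *)
have le_sr : count_mem s u <= count_mem r u.
  rewrite leqNgt; apply/negP => lt_rs.
  have hj : count_mem r u < count_mem s (x :: u).
    by rewrite /=; apply: leq_trans lt_rs (leq_addl _ _).
  have := hn _ hj; move: hc.
  case/andP: (nth_positions_le lt_rs) => _ hle /=.
  case: (eqVneq x r) => [->|xr] /=; last first.
    rewrite add0n => hc' _; move: lt_rs.
    by rewrite ltnNge (leq_trans _ hc') ?leq_addl.
  rewrite (ltn_eqF rs) nth_rcons size_positions ltnn eqxx.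
  by move=> _ /leq_trans/(_ hle); rewrite ltnNge leqnSn.
split=> // j hj.
have hj' : j < count_mem s (x :: u).
  by rewrite /=; apply: leq_trans hj (leq_addl _ _).
have := hn _ hj'; rewrite /=.
have hr := leq_trans hj le_sr.
have -> : nth 0 (if x == r then rcons (positions r u) (size u).+1
                 else positions r u) j = nth 0 (positions r u) j.
  by case: eqP => // _; rewrite nth_rcons_lt ?size_positions.
case: eqP => // _; by rewrite nth_rcons_lt ?size_positions.
Qed.

(** * The bijection between standard tableaux and lattice words *)

Definition entry (la : seq nat) (T : tabl la) (r j : nat) : nat :=
  if (insub r : option 'I_(size la), insub j : option 'I_(sumn la))
    is (Some r', Some j') then val (T (r', j')) else 0.

(** The conditions on a standard tableau, for a function of unbounded indices of which only the
    values inside the diagram matter. This avoids ordinals when passing to and from words. *)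
Record young (la : seq nat) (t : nat -> nat -> nat) : Prop := Young {
  young_bound : forall r j, j < nth 0 la r -> 0 < t r j <= sumn la;
  young_onto : forall m, 0 < m <= sumn la ->
    exists r j, j < nth 0 la r /\ t r j = m;
  young_inj : forall r j r' j', j < nth 0 la r -> j' < nth 0 la r' ->
    t r j = t r' j' -> r = r' /\ j = j';
  young_row : forall r j j', j < j' < nth 0 la r -> t r j < t r j';
  young_col : forall r r' j, r < r' -> j < nth 0 la r -> j < nth 0 la r' ->
    t r j < t r' j }.

Section Entries.
Variable la : seq nat.
Implicit Types T : tabl la.

Lemma entryE T (c : 'I_(size la) * 'I_(sumn la)) : entry T c.1 c.2 = T c.
Proof. by rewrite /entry !valK; case: c. Qed.

Lemma nth_le_sumn r : nth 0 la r <= sumn la.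
Proof.
elim: la r => [|x s IH] [|r] //=; first exact: leq_addr.
exact: leq_trans (IH r) (leq_addl _ _).
Qed.

Lemma lt_nth_size r j : j < nth 0 la r -> r < size la.
Proof.
by move=> h; rewrite ltnNge; apply/negP => /(nth_default 0) e; rewrite e in h.
Qed.

Lemma cell_of r j : j < nth 0 la r ->
  exists2 c : 'I_(size la) * 'I_(sumn la), in_shape c & r = c.1 /\ j = c.2.
Proof.
move=> h; have hj := leq_trans h (nth_le_sumn r).
by exists (Ordinal (lt_nth_size h), Ordinal hj).
Qed.

Lemma entry_inj T T' : (forall r j, entry T r j = entry T' r j) -> T = T'.
Proof. by move=> H; apply/ffunP=> c; apply: val_inj; rewrite /= -!entryE H. Qed.

Lemma is_sytP T : is_syt T <->
  (forall r j, nth 0 la r <= j -> entry T r j = 0) /\ young la (entry T).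
Proof.
split.
  case/and5P=> /forallP h1 /forallP h2 /forallP h3 /forallP h4.
  case/andP=> /forallP h5 /forallP h6; split=> [r j hrj|].
    rewrite /entry; case: insubP => // r' _ er; case: insubP => // j' _ ej.
    have := h1 (r', j'); rewrite /in_shape /= -leqNgt er ej hrj /=.
    by move/eqP->.
  split=> [r j|m|r j r' j'|r j j'|r r' j].
  - case/cell_of=> c hc [-> ->]; rewrite entryE -[_ <= sumn la]ltnS ltn_ord andbT.
    by have := h2 c; rewrite hc.
  - case/andP=> m0 mN; have := h3 (Ordinal (mN : m < (sumn la).+1)).
    rewrite /= m0 => /existsP[c /andP[hc /eqP e]].
    by exists c.1, c.2; rewrite entryE e.
  - case/cell_of=> c hc [-> ->]; case/cell_of=> d hd [-> ->].
    rewrite !entryE => e; have /forallP/(_ d) := h4 c.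
    by rewrite hc hd -val_eqE /= e eqxx => /eqP->.
  - case/andP=> jj hj'; case/cell_of: (hj') => d hd [er ej'].
    case/cell_of: (ltn_trans jj hj') => c hc [er' ej].
    have /forallP/(_ d) := h5 c.
    by rewrite -!entryE hc hd -ej -ej' -er' -er eqxx jj.
  move=> rr; case/cell_of=> c hc [er ej]; case/cell_of=> d hd [er' ej'].
  have /forallP/(_ d) := h6 c.
  by rewrite -!entryE hc hd -ej -ej' -er' -er eqxx rr.
case=> h0 [h1 h2 h3 h4 h5]; apply/and5P; split.
- apply/forallP=> c; apply/implyP; rewrite /in_shape -leqNgt => /h0.
  by rewrite entryE => e; apply/eqP/val_inj.
- by apply/forallP=> c; apply/implyP=> /h1; rewrite entryE => /andP[].
- apply/forallP=> m; apply/implyP=> m0.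
  have := ltn_ord m; rewrite ltnS => mN.
  have /h2[r [j [hrj e]]] : 0 < m <= sumn la by rewrite m0.
  case/cell_of: (hrj) => c hc [er ej].
  apply/existsP; exists c; rewrite hc /=; apply/eqP/val_inj.
  by rewrite /= -entryE -er -ej.
- apply/forallP=> c; apply/forallP=> d; apply/implyP=> /and3P[hc hd /eqP e].
  have [] := h3 _ _ _ _ hc hd; first by rewrite !entryE e.
  by case: c d {hc hd e} => [r j] [r' j'] /= /val_inj-> /val_inj->.
apply/andP; split.
  apply/forallP=> c; apply/forallP=> d; apply/implyP.
  case/and4P=> hc hd /eqP e lt_cd; rewrite -!entryE e.
  by apply: h4; rewrite lt_cd.
apply/forallP=> c; apply/forallP=> d; apply/implyP.
case/and4P=> hc hd /eqP e lt_cd; rewrite -!entryE e.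
by apply: h5 => //; rewrite -e.
Qed.

Lemma row_of_young T r j :
  young la (entry T) -> j < nth 0 la r -> row_of T (entry T r j) = r.
Proof.
move=> yT hrj; rewrite /row_of; case: pickP => [c /andP[hc /eqP]|].
  by rewrite /= -entryE => /(young_inj yT hc hrj)[].
case/cell_of: (hrj) => c hc [-> ->] /(_ c).
by rewrite hc entryE /= eqxx.
Qed.

Definition tabl_of (t : nat -> nat -> nat) : tabl la :=
  [ffun c => if in_shape c then inord (t c.1 c.2) else ord0].

Lemma entry_tabl_of t r j : young la t ->
  entry (tabl_of t) r j = if j < nth 0 la r then t r j else 0.
Proof.
move=> yt; case: ifP => [hrj|nrj].
  case/cell_of: (hrj) => c hc [er ej].
  rewrite er ej entryE ffunE hc inordK // -er -ej ltnS.
  by case/andP: (young_bound yt hrj).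
rewrite /entry; case: insubP => // r' _ er; case: insubP => // j' _ ej.
by rewrite ffunE /in_shape /= er ej nrj.
Qed.

Lemma young_eq t t' : (forall r j, j < nth 0 la r -> t r j = t' r j) ->
  young la t -> young la t'.
Proof.
move=> e [h1 h2 h3 h4 h5]; split.
- by move=> r j h; rewrite -e // h1.
- by move=> m /h2[r [j [h <-]]]; exists r, j; rewrite e.
- by move=> r j r' j' h h'; rewrite -!e //; apply: h3.
- move=> r j j' h; case/andP: (h) => jj hj'; rewrite -!e //; first exact: h4.
  exact: ltn_trans hj'.
by move=> r r' j rr h h'; rewrite -!e //; apply: h5.
Qed.

Lemma is_syt_tabl_of t : young la t -> is_syt (tabl_of t).
Proof.
move=> yt; apply/is_sytP; split=> [r j|].
  by rewrite entry_tabl_of // leqNgt => /negbTE->.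
by apply: (young_eq _ yt) => r j h; rewrite (entry_tabl_of _ _ yt) h.
Qed.

Definition syt_word T : seq nat := word_of (row_of T) (sumn la).

(** Both lists increase strictly and have the same members, so they agree. Hence the word determines
    every row of the tableau. *)
Lemma positions_syt_word T r : is_syt T ->
  positions r (syt_word T) = [seq entry T r j | j <- iota 0 (nth 0 la r)].
Proof.
case/is_sytP=> _ yT; apply: (irr_sorted_eq ltn_trans ltnn).
- exact: positions_sorted.
- apply: (homo_sorted_in (P := gtn (nth 0 la r)) (e := ltn)).
  + by move=> i j _ hj ij; apply: (young_row yT); apply/andP.
  + by apply/allP=> j; rewrite mem_iota.
  + exact: iota_ltn_sorted.
move=> m; rewrite mem_positions size_word_of.
apply/andP/mapP=> [[hm]|[j]].
  rewrite nth_word_of // => /eqP er.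
  have [r' [j [hj em]]] := young_onto yT hm.
  move: er; rewrite -em row_of_young // => ?; subst r'.
  by exists j; rewrite ?mem_iota.
rewrite mem_iota /= => hj ->.
have hb := young_bound yT hj; split=> //.
by rewrite nth_word_of // row_of_young.
Qed.

Lemma count_syt_word T r : is_syt T -> count_mem r (syt_word T) = nth 0 la r.
Proof.
by move=> sT; rewrite -size_positions positions_syt_word // size_map size_iota.
Qed.

Lemma content_syt_word T : is_syt T -> content (size la) (syt_word T) = la.
Proof.
move=> sT; apply: (@eq_from_nth _ 0); rewrite size_map size_iota // => r hr.
by rewrite (nth_map 0) ?size_iota // nth_iota // count_syt_word.
Qed.

Lemma syt_word_lattice T : sorted geq la -> is_syt T ->
  lattice (size la) (syt_word T).
Proof.
move=> so sT; apply/latticeP => r s rsk; case/andP: (rsk) => rs sk.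
have le_sr : count_mem s (syt_word T) <= count_mem r (syt_word T).
  by apply: (content_sortedP _ _ _ r s rsk); rewrite content_syt_word.
split=> // j; rewrite !count_syt_word // in le_sr * => hj.
have hr := leq_trans hj le_sr.
rewrite !positions_syt_word // !(nth_map 0) ?size_iota // !nth_iota //.
by case/is_sytP: sT => _ yT; apply: (young_col yT).
Qed.

Lemma syt_word_letters T : is_syt T -> all (gtn (size la)) (syt_word T).
Proof.
case/is_sytP=> _ yT; apply/(all_nthP 0); rewrite size_word_of => i hi.
have hb : 0 < sumn la - i <= sumn la by rewrite subn_gt0 hi leq_subr.
rewrite /syt_word -{1}[i](subKn (ltnW hi)) nth_word_of //.
have [r [j [hj <-]]] := young_onto yT hb.
by rewrite row_of_young //=; apply: lt_nth_size hj.
Qed.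

Lemma syt_word_inj : {in @is_syt la &, injective syt_word}.
Proof.
move=> T T' sT sT' e; apply: entry_inj => r j.
case: (ltnP j (nth 0 la r)) => hj; last first.
  by case/is_sytP: sT sT' => z _ /is_sytP[z' _]; rewrite z ?z'.
have := positions_syt_word r sT; rewrite e positions_syt_word // => /eq_in_map.
by move/(_ j); rewrite mem_iota => ->.
Qed.

Lemma word_of_nth u : word_of (fun m => nth 0 u (size u - m)) (size u) = u.
Proof.
apply: (@eq_from_nth _ 0); rewrite size_word_of // => i hi.
rewrite -{1}[i](subKn (ltnW hi)) nth_word_of ?subKn ?subn_gt0 ?hi ?leq_subr //.
exact: ltnW.
Qed.

Lemma eq_word_of f g N : (forall m, 0 < m <= N -> f m = g m) ->
  word_of f N = word_of g N.
Proof.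
elim: N => //= N IH e; rewrite e ?leqnn // IH // => m /andP[m0 mN].
by rewrite e // m0 leqW.
Qed.

Lemma syt_word_onto u : sorted geq la -> all (gtn (size la)) u ->
  size u = sumn la -> lattice (size la) u -> content (size la) u = la ->
  exists2 T, is_syt T & syt_word T = u.
Proof.
move=> so au su lu cu.
have cnt r : r < size la -> count_mem r u = nth 0 la r.
  by move=> hr; rewrite -[in RHS]cu (nth_map 0) ?size_iota // nth_iota.
(* The inverse map: cell (r, j) receives the position of the j-th letter [r]. *)
pose t r j := nth 0 (positions r u) j.
have tP r j : j < nth 0 la r ->
    0 < t r j <= size u /\ nth 0 u (size u - t r j) = r.
  move=> hj; have : t r j \in positions r u.
    by rewrite mem_nth // size_positions cnt // (lt_nth_size hj).
  by rewrite mem_positions => /andP[? /eqP].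
have sz r j : j < nth 0 la r -> j < size (positions r u).
  by move=> hj; rewrite size_positions cnt // (lt_nth_size hj).
have yt : young la t.
  split=> [r j /tP[]|m|r j r' j' h h' e|r j j'|r r' j rr h h'].
  - by rewrite su.
  - rewrite -su => hm; set r := nth 0 u (size u - m).
    have hr : r < size la.
      by apply: (all_nthP 0 au); case/andP: hm => m0 mN;
         rewrite ltn_subrL m0 (leq_trans m0 mN).
    have hm' : m \in positions r u by rewrite mem_positions hm eqxx.
    exists r, (index m (positions r u)); split; last exact: nth_index.
    by rewrite -cnt // -size_positions index_mem.
  - have er : r = r'.
      by rewrite -(proj2 (tP _ _ h)) e (proj2 (tP _ _ h')).
    split=> //; subst r'; apply/eqP.
    rewrite -(nth_uniq 0 (sz _ _ h) (sz _ _ h')); first exact/eqP.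
    exact: (sorted_uniq ltn_trans ltnn (positions_sorted r u)).
  - case/andP=> jj hj'; apply: (sorted_ltn_nth ltn_trans) => //.
    + exact: positions_sorted.
    + by apply: sz; apply: ltn_trans hj'.
    + exact: sz.
  (* Increase down the columns is the lattice condition in the form of [latticeP]. *)
  have [_] := (latticeP _ _).1 lu r r' (introT andP (conj rr (lt_nth_size h'))).
  by apply; rewrite cnt // (lt_nth_size h').
have sT := is_syt_tabl_of yt; exists (tabl_of t) => //.
rewrite -[u in RHS]word_of_nth /syt_word su; apply: eq_word_of => m.
move/(young_onto yt)=> [r [j [hj em]]].
have := row_of_young ((is_sytP _).1 sT).2 hj.
by rewrite entry_tabl_of // hj em => ->; rewrite -su -em (proj2 (tP _ _ hj)).
Qed.

(** Neither list has duplicates, so the bijection becomes a permutation of lists, along which sums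
    can be reindexed. *)
Lemma perm_syt_words : sorted geq la ->
  perm_eq [seq syt_word T | T <- enum (@is_syt la)]
    [seq u <- words (size la) (sumn la) |
       lattice (size la) u && (content (size la) u == la)].
Proof.
move=> so; apply: uniq_perm.
- rewrite map_inj_in_uniq ?enum_uniq // => T T'.
  by rewrite !mem_enum; apply: syt_word_inj.
- by rewrite filter_uniq ?words_uniq.
move=> u; rewrite mem_filter mem_words; apply/mapP/idP.
  case=> T; rewrite mem_enum => sT ->.
  rewrite syt_word_lattice // content_syt_word // eqxx size_word_of eqxx.
  exact: syt_word_letters.
case/andP=> /andP[lu /eqP cu] /andP[/eqP su au].
have [T sT e] := syt_word_onto so au su lu cu.
by exists T; rewrite ?mem_enum.
Qed.

Local Open Scope ring_scope.

Lemma fpoly_words i : sorted geq la ->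
  fpoly la i = \sum_(u <- words (size la) (sumn la) |
    [&& lattice (size la) u, content (size la) u == la & word_des u == i])
      'X^(word_maj u).
Proof.
move=> so; rewrite /fpoly.
under [RHS]eq_bigl do rewrite andbA.
rewrite -big_filter_cond -(perm_big _ (perm_syt_words so)) /= big_map.
rewrite big_enum_cond /=; apply: eq_big => [T|T _].
  by rewrite word_des_word_of.
by rewrite word_maj_word_of.
Qed.

End Entries.

(** * Removal of the largest entry *)

Lemma content_cons k r u : r < k ->
  content k (r :: u) = incr_nth (content k u) r.
Proof.
move=> rk; apply: (@eq_from_nth _ 0) => [|i].
  by rewrite size_incr_nth !size_map size_iota rk.
rewrite size_map size_iota => ik.
by rewrite nth_incr_nth !(nth_map 0) ?size_iota // nth_iota.
Qed.

Lemma incr_nth_injr r (s t : seq nat) :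
  size s = size t -> incr_nth s r = incr_nth t r -> s = t.
Proof.
move=> est e; apply: (@eq_from_nth _ 0) => // i _.
have := congr1 (fun s => nth 0 s i) e.
by rewrite !nth_incr_nth => /addnI.
Qed.

Lemma sumn_incr_nth la r : sumn (incr_nth la r) = (sumn la).+1.
Proof.
elim: la r => [r|x s IH [|r]] //=; last by rewrite IH addnS.
by case: r => //= r; elim: r.
Qed.

Lemma lattice_sorted k u : u != [::] -> lattice k u -> sorted geq (content k u).
Proof. by case: u => // x u _ /andP[]. Qed.

Local Open Scope ring_scope.

Section WordSums.
Variables (K : comNzRingType) (q : K).

(** Multiplication by t on generating functions in which t marks the number of descents. *)
Definition shift (f : nat -> K) (i : nat) : K := if i is j.+1 then f j else 0.

Definition shape_word (la : seq nat) (i : nat) (u : seq nat) : bool :=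
  [&& lattice (size la) u, content (size la) u == la & word_des u == i].

Definition word_sum (la : seq nat) (i : nat) : K :=
  \sum_(u <- words (size la) (sumn la) | shape_word la i u) q ^+ word_maj u.

(* The contribution of the words starting with [r], that is, of the tableaux
   whose largest entry lies in row [r]. *)
Definition head_sum (r : nat) (la : seq nat) (i : nat) : K :=
  \sum_(v <- words (size la) (sumn la).-1 | shape_word la i (r :: v))
    q ^+ word_maj (r :: v).

Lemma big_words_cons k N (P : pred (seq nat)) (F : seq nat -> K) :
  \sum_(u <- words k N.+1 | P u) F u =
  \sum_(x <- iota 0 k) \sum_(v <- words k N | P (x :: v)) F (x :: v).
Proof.
rewrite big_mkcond /= big_allpairs_dep; apply: eq_bigr => x _.
by rewrite [RHS]big_mkcond.
Qed.

Lemma word_sum_head la i : (0 < sumn la)%N ->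
  word_sum la i = \sum_(x <- iota 0 (size la)) head_sum x la i.
Proof.
by rewrite /word_sum /head_sum; case: (sumn la) => // N _; rewrite big_words_cons.
Qed.

Lemma word_sum_unsorted la i :
  (0 < sumn la)%N -> ~~ sorted geq la -> word_sum la i = 0.
Proof.
move=> la0 nso; rewrite /word_sum big_seq_cond big_pred0 // => u.
apply/negP => /andP[]; rewrite mem_words => /andP[/eqP su _] /and3P[lu /eqP cu _].
move: nso; rewrite -[X in sorted _ X]cu lattice_sorted //.
by rewrite -size_eq0 su -lt0n.
Qed.

Lemma head_sum_empty_row r la i :
  (r < size la)%N -> nth 0%N la r = 0%N -> head_sum r la i = 0.
Proof.
move=> rk lar; rewrite /head_sum big_pred0 // => v.
apply/negP => /and3P[_ /eqP cu _].
by move: lar; rewrite -[X in nth _ X]cu content_cons // nth_incr_nth eqxx.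
Qed.

Lemma shape_word_cons r la i v : (r < size la)%N ->
  shape_word (incr_nth la r) i (r :: v) =
  [&& sorted geq (incr_nth la r), lattice (size la) v,
      content (size la) v == la & ((head r v < r) + word_des v == i)%N].
Proof.
move=> rk; rewrite /shape_word size_incr_nth rk /= content_cons //.
have -> : (incr_nth (content (size la) v) r == incr_nth la r)
          = (content (size la) v == la).
  apply/eqP/eqP => [|-> //]; apply: incr_nth_injr.
  by rewrite size_map size_iota.
case: eqP => [->|_]; last by rewrite !andbF.
by rewrite -!andbA.
Qed.

(** The tail of a lattice word is a lattice word, so the largest entry can lie in row [r] only if
    its removal leaves a partition. *)
Lemma head_sum_unsorted r la i : (r < size la)%N -> (0 < sumn la)%N ->
  ~~ sorted geq la -> head_sum r (incr_nth la r) i = 0.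
Proof.
move=> rk la0 nso; rewrite /head_sum big_seq_cond big_pred0 // => v.
rewrite size_incr_nth rk sumn_incr_nth /= mem_words shape_word_cons //.
apply/negP => /and4P[/andP[/eqP su _] _ lu /andP[/eqP cu _]].
move: nso; rewrite -[X in sorted _ X]cu lattice_sorted //.
by rewrite -size_eq0 su -lt0n.
Qed.

(** A largest entry in the top row creates no descent, so its removal preserves both statistics. *)
Lemma head_sum0 la i : (0 < size la)%N -> sorted geq (incr_nth la 0) ->
  head_sum 0 (incr_nth la 0) i = word_sum la i.
Proof.
move=> k0 so; rewrite /head_sum /word_sum size_incr_nth k0 sumn_incr_nth /=.
by apply: eq_bigl => v; rewrite shape_word_cons // so.
Qed.

(* Removing the largest entry [N+1] from row [r] leaves a largest entry [N] in
   some row [y], and creates a descent at [N] exactly when [y < r]. *)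
Lemma head_sum_rec r la i : (r < size la)%N -> (0 < sumn la)%N ->
  sorted geq (incr_nth la r) ->
  head_sum r (incr_nth la r) i =
  \sum_(y <- iota 0 (size la))
    if (y < r)%N then q ^+ sumn la * shift (head_sum y la) i else head_sum y la i.
Proof.
move=> rk la0 so; rewrite {1}/head_sum size_incr_nth rk sumn_incr_nth [_.+1.-1]/=.
under eq_bigl do rewrite shape_word_cons // so.
rewrite /head_sum -(prednK la0) big_words_cons; apply: eq_bigr => y _.
case: ifP => yr; last first.
  by apply: eq_big => v //=; rewrite yr mul0n !add0n.
case: i => [|i] /=.
  by rewrite mulr0 big_pred0 // => v /=; rewrite !andbF.
rewrite mulr_sumr.
rewrite big_seq_cond [RHS]big_seq_cond; apply: eq_big => [v|v] /=.
  by rewrite add1n eqSS.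
case/andP; rewrite mem_words => /andP[/eqP-> _] _.
by rewrite yr mul1n exprD.
Qed.

(** * Recursions for shapes with three rows *)

Notation tot a b c := (word_sum [:: a; b; c]%N).
Notation top r a b c := (head_sum r [:: a; b; c]%N).

(** Splits by the row of the largest entry. The case b = a + 1 is allowed; [tot a b c] is then
    zero. *)
Lemma word_sum3_recl a b c i : (c <= b <= a.+1)%N ->
  tot a.+1 b c i = tot a b c i + top 1 a.+1 b c i + top 2 a.+1 b c i.
Proof.
case/andP=> cb ba; rewrite word_sum_head //= !big_cons big_nil addr0 addrA.
by rewrite -(@head_sum0 [:: a; b; c]%N) //= cb ba.
Qed.

(** A second-row entry creates a descent exactly after a first-row entry, and the words of shape (a
    + 1, b, c) starting with 0 sum to [tot a b c]. The other words of that shape sum to a difference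
    of totals, so only totals with a shorter second row remain. *)
Lemma head_sum1_rec a b c i : (c <= b <= a)%N ->
  top 1 a.+1 b.+1 c i = tot a.+1 b c i - tot a b c i
    + q ^+ (a.+1 + b + c) * shift (tot a b c) i.
Proof.
case/andP=> cb ba.
rewrite (@head_sum_rec 1 [:: a.+1; b; c]%N) //=; last by rewrite ltnS ba leqW.
rewrite !big_cons big_nil /= addr0 (@word_sum3_recl a b c i) ?cb ?leqW //.
have -> : shift (top 0 a.+1 b c) i = shift (tot a b c) i.
  case: i => //= i; rewrite -(@head_sum0 [:: a; b; c]%N) //=.
  by rewrite cb leqW.
by rewrite addn0 addnA; ring.
Qed.

Lemma head_sum1_eq a b i : (b <= a)%N -> top 1 a b b i = 0.
Proof.
case: b => [|b] ba; first exact: head_sum_empty_row.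
apply: (@head_sum_unsorted 1 [:: a; b; b.+1]%N) => //=.
  by lia.
by rewrite ltnn !andbF.
Qed.

(** A third-row entry creates a descent unless its predecessor is also in the third row; the
    complement of [top 2 a b c] in the total is what gets shifted. *)
Lemma head_sum2_rec a b c i : (c < b <= a)%N ->
  top 2 a b c.+1 i = top 2 a b c i
    + q ^+ (a + b + c) * shift (fun j => tot a b c j - top 2 a b c j) i.
Proof.
case/andP=> cb ba; have a0 : (0 < a)%N by lia.
have s0 : (0 < sumn [:: a; b; c])%N by rewrite /= addn_gt0 a0.
rewrite (@head_sum_rec 2 [:: a; b; c]%N) //=; last by rewrite cb ba.
rewrite !big_cons big_nil /= addr0 addn0 addnA.
case: i => [|i] /=; first by rewrite !mulr0 !add0r addr0.
rewrite word_sum_head //= !big_cons big_nil addr0; ring.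
Qed.

Lemma head_sum2_0 a b i : top 2 a b 0 i = 0.
Proof. exact: head_sum_empty_row. Qed.

(** The shape is not a partition. This vanishing is the initial value of the recursion in a. *)
Lemma word_sum3_unsorted a c i : (c <= a.+1)%N -> tot a a.+1 c i = 0.
Proof.
by move=> ca; apply: word_sum_unsorted => /=; rewrite ?addnS ?addSn // ltnn.
Qed.

Lemma word_sum3_0 i : tot 0 0 0 i = (i == 0%N)%:R.
Proof.
rewrite /word_sum /= big_mkcond big_seq1 /shape_word /=.
by case: i => [|i]; rewrite //= expr0.
Qed.

End WordSums.

Lemma fq_word_sum la i : sorted geq la ->
  fq la i = word_sum (qX 1) la i.
Proof.
move=> so; rewrite /fq fpoly_words // /tofracq rmorph_sum /=.
by apply: eq_bigr => u _; rewrite rmorphXn.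
Qed.

(** * Closed forms in q and x, and their expression by q-binomials *)

Section ClosedForms.
Variables (K : fieldType) (q : K).

(* The i-th item is the sum over the words of shape (a, b, c) with i descents,
   as a function of [x = q ^+ a]. *)
Definition closed_form (b c : nat) (x : K) : nat -> K := nth 0
  match b, c with
  | 0, 0 => [:: 1]
  | 1, 0 => [:: 0; q * (1 - x) / (1 - q)]
  | 1, 1 => [:: 0; 0; q ^+ 3 * (1 - x) * (1 - q * x) / ((1 - q) ^+ 2 * (1 + q))]
  | 2, 0 => [:: 0; q * (q - x) / (1 - q);
      q ^+ 3 * (q - x) * (1 - x) / ((1 - q) ^+ 2 * (1 + q))]
  | 2, 1 => [:: 0; 0; q ^+ 3 * (q - x) * (1 - q * x) / (1 - q) ^+ 2;
      q ^+ 6 * (q - x) * (1 - x) * (1 - q * x)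
        / ((1 - q) ^+ 3 * (1 + q + q ^+ 2))]
  | 2, 2 => [:: 0; 0; q ^+ 5 * (q - x) * (1 - x) / ((1 - q) ^+ 2 * (1 + q));
      q ^+ 7 * (q - x) * (1 - x) * (1 - q * x) / ((1 - q) ^+ 3 * (1 + q));
      q ^+ 11 * (q - x) * (1 - x) ^+ 2 * (1 - q * x)
        / ((1 - q) ^+ 4 * (1 + q) ^+ 2 * (1 + q + q ^+ 2))]
  | 3, 0 => [:: 0; q * (q ^+ 2 - x) / (1 - q);
      q ^+ 3 * (q ^+ 2 - x) * (1 - x) / (1 - q) ^+ 2;
      q ^+ 6 * (q ^+ 2 - x) * (q - x) * (1 - x)
        / ((1 - q) ^+ 3 * (1 + q) * (1 + q + q ^+ 2))]
  | 3, 1 => [:: 0; 0;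
      q ^+ 3 * (q ^+ 2 - x) * (1 - q * x) * (1 + q + q ^+ 2)
        / ((1 - q) ^+ 2 * (1 + q));
      q ^+ 6 * (q ^+ 2 - x) * (1 - x) * (1 - q * x) / (1 - q) ^+ 3;
      q ^+ 10 * (q ^+ 2 - x) * (q - x) * (1 - x) * (1 - q * x)
        / ((1 - q) ^+ 4 * (1 + q) ^+ 2 * (1 + q ^+ 2))]
  | 3, 2 => [:: 0; 0; q ^+ 5 * (q ^+ 2 - x) * (1 - x) / (1 - q) ^+ 2;
      q ^+ 7 * (q ^+ 2 - x) * (1 - x) * (1 - q * x) * (1 + q + q ^+ 2)
        / ((1 - q) ^+ 3 * (1 + q));
      q ^+ 11 * (q ^+ 2 - x) * (1 - x) ^+ 2 * (1 - q * x)
        / ((1 - q) ^+ 4 * (1 + q));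
      q ^+ 16 * (q ^+ 2 - x) * (q - x) * (1 - x) ^+ 2 * (1 - q * x)
        / ((1 - q) ^+ 5 * (1 + q) ^+ 2 * (1 + q + q ^+ 2) * (1 + q ^+ 2))]
  | 3, 3 => [:: 0; 0;
      q ^+ 6 * (q ^+ 2 - x) * (q - x) / ((1 - q) ^+ 2 * (1 + q));
      q ^+ 8 * (q ^+ 2 - x) * (q - x)
        * (1 + 2 * q + 2 * q ^+ 2 + q ^+ 3 + q ^+ 4
           - x * (q + q ^+ 2 + 2 * q ^+ 3 + 2 * q ^+ 4 + q ^+ 5))
        / ((1 - q) ^+ 3 * (1 + q) * (1 + q + q ^+ 2));
      q ^+ 12 * (q ^+ 2 - x) * (q - x) * (1 - q * x)
        * (2 + 2 * q + 2 * q ^+ 2 + q ^+ 3 + q ^+ 4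
           - x * (1 + q + 2 * q ^+ 2 + 2 * q ^+ 3 + 2 * q ^+ 4))
        / ((1 - q) ^+ 4 * (1 + q) ^+ 2 * (1 + q + q ^+ 2));
      q ^+ 17 * (q ^+ 2 - x) * (q - x) * (1 - x) * (1 - q * x)
        * (1 + q + q ^+ 3 - x * (1 + q ^+ 2 + q ^+ 3))
        / ((1 - q) ^+ 5 * (1 + q) ^+ 2 * (1 + q + q ^+ 2) * (1 + q ^+ 2));
      q ^+ 23 * (q ^+ 2 - x) * (q - x) ^+ 2 * (1 - x) ^+ 2 * (1 - q * x)
        / ((1 - q) ^+ 6 * (1 + q) ^+ 3 * (1 + q + q ^+ 2) ^+ 2 * (1 + q ^+ 2))]
  | _, _ => [::]
  end.

(* [head2_form] is taken at [x = q ^+ a], but [head1_form] at the shape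
   (a + 1, b, c) for [x = q ^+ a], so that no division by [q] occurs. *)
Fixpoint head2_form (b c : nat) (x : K) (i : nat) : K :=
  if c is c'.+1 then
    head2_form b c' x i + q ^+ (b + c') * x
      * shift (fun j => closed_form b c' x j - head2_form b c' x j) i
  else 0.

Definition head1_form (b c : nat) (x : K) (i : nat) : K :=
  if b is b'.+1 then
    if (c < b)%N then
      closed_form b' c (q * x) i - closed_form b' c x i
      + q ^+ (b' + c) * (q * x) * shift (closed_form b' c x) i
    else 0
  else 0.

Hypotheses (q1 : 1 - q != 0) (q2 : 1 + q != 0)
  (q3 : 1 + q + q ^+ 2 != 0) (q4 : 1 + q ^+ 2 != 0).

(** The counterpart of [word_sum3_recl], with [x] for q^a and [q * x] for q^(a+1). Since [x] is
    free, each of the ten pairs (b, c) and each number of descents gives one identity of rational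
    functions; from 7 descents on all terms vanish. *)
Lemma closed_form_rec b c x i : (c <= b <= 3)%N ->
  closed_form b c (q * x) i =
    closed_form b c x i + head1_form b c x i + head2_form b c (q * x) i.
Proof.
case/andP=> cb b3.
case: b b3 cb => [|[|[|[|b]]]] // _; case: c => [|[|[|[|c]]]] //= _;
  rewrite /closed_form; case: i => [|[|[|[|[|[|[|i]]]]]]] /=; rewrite ?nth_nil;
  try ring; by field; rewrite ?q1 ?q2 ?q3 ?q4.
Qed.

(** Every nonzero item for the second row b + 1 has the factor q^b - x in its numerator. *)
Lemma closed_form_vanish b c i :
  (c <= b.+1 <= 3)%N -> closed_form b.+1 c (q ^+ b) i = 0.
Proof.
case/andP=> cb b3.
case: b b3 cb => [|[|[|b]]] // _; case: c => [|[|[|[|c]]]] //= _;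
  rewrite /closed_form; case: i => [|[|[|[|[|[|[|i]]]]]]] /=; rewrite ?nth_nil;
  by rewrite // ?expr0 ?expr1 subrr ?expr0n /= !(mulr0, mul0r).
Qed.

Notation tot a b c := (word_sum q [:: a; b; c]%N).
Notation top r a b c := (head_sum q r [:: a; b; c]%N).

(** Unrolls [head_sum2_rec] down to an empty third row; only totals with smaller third row enter. *)
Lemma head_sum2_form a b c i : (c <= b <= a)%N ->
  (forall c' j, (c' < c)%N -> tot a b c' j = closed_form b c' (q ^+ a) j) ->
  top 2 a b c i = head2_form b c (q ^+ a) i.
Proof.
elim: c i => [|c IH] i /andP[cb ba] H; first by rewrite head_sum2_0.
have IH' j : top 2 a b c j = head2_form b c (q ^+ a) j.
  by apply: IH => [|c' k /ltnW]; [rewrite ltnW | apply: H].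
rewrite head_sum2_rec ?cb //= IH' -addnA addnC exprD.
by congr (_ + _ * _); case: i => //= i; rewrite IH' H.
Qed.

(** Nested inductions on b, c and a: both sides satisfy the same recursion in a, whose second-row
    term involves smaller b and whose third-row term involves smaller c. *)
Lemma word_sum_closed_form a b c i : (c <= b <= 3)%N -> (b <= a.+1)%N ->
  tot a b c i = closed_form b c (q ^+ a) i.
Proof.
elim: b c a i => [|b IHb].
  case=> // a i _ _; elim: a => [|a IHa].
    by rewrite word_sum3_0; case: i => [|[]].
  by rewrite word_sum3_recl // head_sum1_eq // head_sum2_0 !addr0 IHa.
(* Strong induction on [c], as the third-row term uses all smaller values. *)
move=> c; have [k] := ubnP c; elim: k c => // k IHk c ck a i /andP[cb b3].
elim: a i => [|a IHa] i.
  rewrite ltnS leqn0 => /eqP b0; rewrite b0 in cb b3 *.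
  by rewrite word_sum3_unsorted // (@closed_form_vanish 0) // cb.
(* When [b = a.+1], the first row is one cell shorter than the second and both sides vanish. *)
rewrite leq_eqVlt => /predU1P[[e]|ba].
  by rewrite e in cb b3 *; rewrite word_sum3_unsorted // closed_form_vanish // cb.
rewrite word_sum3_recl ?cb // IHa // exprS closed_form_rec ?cb //.
congr (_ + _ + _).
  (* The second-row term reduces to totals with second row [b], or vanishes when the two lower rows
     have equal length. *)
  rewrite /head1_form; case: ltnP => [cb1|bc].
    rewrite ltnS in cb1; have cb3 : (c <= b <= 3)%N by rewrite cb1 ltnW.
    have ba' : (b <= a.+1)%N by exact: ltnW.
    rewrite head_sum1_rec ?cb1 // !IHb // 1?leqW //.
    rewrite -addnA addnC exprD exprS; congr (_ + _ * _).
    by case: i => //= i; rewrite IHb.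
  have -> : c = b.+1 by apply/eqP; rewrite eqn_leq cb.
  by rewrite head_sum1_eq.
rewrite -exprS; apply: head_sum2_form => [|c' j c'c]; first by rewrite cb.
by apply: IHk; lia.
Qed.

(** The q-binomial as a product, over any field. For M < N it is zero, because truncated subtraction
    makes the factor at k = M equal to 1 - q^0. *)
Definition qbin (M N : nat) : K :=
  \prod_(k < N) (1 - q ^+ (M - k)) / \prod_(k < N) (1 - q ^+ k.+1).

Lemma closed_form33 n : (3 <= n)%N ->
  let f := closed_form 3 3 (q ^+ n) in
  [/\ f 2 = q ^+ 9 * qbin n.-1 2,
      f 3 = q ^+ 11 * qbin n.-1 2 * qbin (n + 3) 1 + q ^+ 12 * qbin n 3 * qbin 4 1,
      f 4 = q ^+ 15 * qbin n.-1 2 * qbin (n + 2) 2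
            + q ^+ 15 * qbin n.+1 4 * qbin 5 2,
      f 5 = q ^+ 21 * qbin n.-1 2 * qbin n.+1 3
            + q ^+ 20 * qbin n.+1 4 * qbin (n + 3) 1 &
      f 6 = q ^+ 27 * ((1 - q ^+ (n - 2)) * (1 - q ^+ n.-1) ^+ 2
                       * (1 - q ^+ n) ^+ 2 * (1 - q ^+ n.+1))
            / ((1 - q ^+ 1) * (1 - q ^+ 2) ^+ 2 * (1 - q ^+ 3) ^+ 2 * (1 - q ^+ 4))
   /\ f 6 = q ^+ 27 * qbin n 3 ^+ 2 - q ^+ 28 * qbin n 4 * qbin n 2].
Proof.
(* With n = m + 3 all exponents are [m] plus a constant, so everything becomes a rational function
   of [q] and [q ^+ m]. *)
case: n => [|[|[|m]]] // _ /=; rewrite /qbin !big_ord_recr !big_ord0 /=.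
have e2 : 1 - q ^+ 2 = (1 - q) * (1 + q) by ring.
have e3 : 1 - q ^+ 3 = (1 - q) * (1 + q + q ^+ 2) by ring.
have e4 : 1 - q ^+ 4 = (1 - q) * (1 + q) * (1 + q ^+ 2) by ring.
rewrite !addnS !addn0 !subSS !subn0 ?expr1 ?e2 ?e3 ?e4 /closed_form /=.
have [x1 x2 x3] : [/\ q ^+ m.+1 = q * q ^+ m, q ^+ m.+2 = q ^+ 2 * q ^+ m
  & q ^+ m.+3 = q ^+ 3 * q ^+ m] by split; rewrite !exprS; ring.
have [x4 x5 x6] : [/\ q ^+ m.+4 = q ^+ 4 * q ^+ m, q ^+ m.+4.+1 = q ^+ 5 * q ^+ m
  & q ^+ m.+4.+2 = q ^+ 6 * q ^+ m] by split; rewrite !exprS; ring.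
rewrite x1 x2 x3 x4 x5 x6.
by split; last split; field; rewrite ?q1 ?q2 ?q3 ?q4.
Qed.

End ClosedForms.

(** * Specialization to the fraction field of Z[q] *)

(** Up to sign these are the first four cyclotomic polynomials, which divide 1 - q^3 or 1 - q^4. All
    denominators of the closed forms are products of them. *)
Lemma cyclotomic_factors_neq0 (K : fieldType) (q : K) :
  (forall k, 1 - q ^+ k.+1 != 0) ->
  [/\ 1 - q != 0, 1 + q != 0, 1 + q + q ^+ 2 != 0 & 1 + q ^+ 2 != 0].
Proof.
move=> H; have := H 3%N; have := H 2%N.
have -> : 1 - q ^+ 3 = (1 - q) * (1 + q + q ^+ 2) by ring.
have -> : 1 - q ^+ 4 = (1 - q) * (1 + q) * (1 + q ^+ 2) by ring.
by rewrite !mulf_eq0 !negb_or => /andP[-> ->] /andP[/andP[_ ->] ->].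
Qed.

Lemma qXE k : qX k = qX 1 ^+ k.
Proof. by rewrite /qX /tofracq rmorphXn. Qed.

Lemma omqE k : omq k = 1 - qX 1 ^+ k.
Proof. by rewrite -qXE /omq /tofracq rmorphB rmorph1. Qed.

(** Nonvanishing is tested by evaluation at 2, where 1 - q^k is nonzero for every k > 0. *)
Lemma tofracq_neq0 (p : {poly int}) : p.[2] != 0 -> p%:F != 0.
Proof.
by apply: contraNneq => /eqP; rewrite tofrac_eq0 => /eqP->; rewrite horner0.
Qed.

Lemma omq_neq0 k : omq k.+1 != 0.
Proof.
apply: tofracq_neq0; rewrite !hornerE subr_eq0 eq_sym.
by rewrite -[2]/(2%:R) -natrX -[1]/(1%:R) Num.Theory.eqr_nat expnS; lia.
Qed.

Lemma qpochS m : (qpoch m.+1)%:F = (qpoch m)%:F * omq m.+1.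
Proof. by rewrite /qpoch big_nat_recr //= /tofracq rmorphM. Qed.

Lemma qpoch_neq0 m : (qpoch m)%:F != 0.
Proof.
elim: m => [|m IH]; last by rewrite qpochS; apply: mulf_neq0 IH (omq_neq0 m).
by apply: tofracq_neq0; rewrite /qpoch big_geq // hornerE.
Qed.

Lemma qbinomE M N : qbinom M N = qbin (qX 1) M N.
Proof.
have den n : \prod_(k < n) (1 - qX 1 ^+ k.+1) = (qpoch n)%:F.
  elim: n => [|n IH]; last by rewrite big_ord_recr /= IH qpochS omqE.
  by rewrite big_ord0 /qpoch big_geq // /tofracq rmorph1.
rewrite /qbin den /qbinom; case: leqP => [NM|MN]; last first.
  by rewrite (bigD1 (Ordinal MN)) //= subnn expr0 subrr !mul0r.
(* The top N factors of (q)_M split off, and (q)_(M-N) cancels. *)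
have -> : (qpoch M)%:F = \prod_(k < N) (1 - qX 1 ^+ (M - k)) * (qpoch (M - N))%:F.
  elim: N NM => [|N IH] NM; first by rewrite big_ord0 mul1r subn0.
  rewrite IH ?(ltnW NM) // big_ord_recr /= -mulrA; congr (_ * _).
  by rewrite -(subnSK NM) qpochS omqE mulrC.
by rewrite -mulf_div divff ?qpoch_neq0 // mulr1.
Qed.

Theorem theoremN33 (n : nat) (hn : (3 <= n)%N) :
  let la := [:: n; 3; 3]%N in
  [/\ fq la 2 = qX 9 * qbinom n.-1 2,
      fq la 3 = qX 11 * qbinom n.-1 2 * qbinom (n + 3) 1
                + qX 12 * qbinom n 3 * qbinom 4 1,
      fq la 4 = qX 15 * qbinom n.-1 2 * qbinom (n + 2) 2
                + qX 15 * qbinom n.+1 4 * qbinom 5 2,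
      fq la 5 = qX 21 * qbinom n.-1 2 * qbinom n.+1 3
                + qX 20 * qbinom n.+1 4 * qbinom (n + 3) 1 &
      fq la 6 = qX 27 * (omq (n - 2) * omq n.-1 ^+ 2 * omq n ^+ 2 * omq n.+1)
                / (omq 1 * omq 2 ^+ 2 * omq 3 ^+ 2 * omq 4)
   /\ fq la 6 = qX 27 * qbinom n 3 ^+ 2 - qX 28 * qbinom n 4 * qbinom n 2].
Proof.
have [q1 q2 q3 q4] : [/\ 1 - qX 1 != 0, 1 + qX 1 != 0,
    1 + qX 1 + qX 1 ^+ 2 != 0 & 1 + qX 1 ^+ 2 != 0].
  by apply: cyclotomic_factors_neq0 => k; rewrite -omqE; apply: omq_neq0.
have so : sorted geq [:: n; 3; 3]%N by rewrite /= hn.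
move=> la; have closed i : fq la i = closed_form (qX 1) 3 3 (qX 1 ^+ n) i.
  rewrite (fq_word_sum i so).
  exact: (word_sum_closed_form q1 q2 q3 q4 i (erefl : (3 <= 3 <= 3)%N) (leqW hn)).
rewrite !closed !omqE !qbinomE [qX 9]qXE [qX 11]qXE [qX 12]qXE [qX 15]qXE.
rewrite [qX 20]qXE [qX 21]qXE [qX 27]qXE [qX 28]qXE.
exact (closed_form33 q1 q2 q3 q4 hn).
Qed.
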